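(* Let $R$ be a ring with identity and let $a,w,d\in R$. (i) Suppose that $a^{\parallel d}$ and $(a^{\parallel d}aw)^{\parallel d}$ exist. If $ad=da$, then $aw$ is invertible along $d$ and $(aw)^{\parallel d}=(a^{\parallel d}aw)^{\parallel d}a^{\parallel d}$. (ii) Suppose that $w^{\parallel d}$ and $(aww^{\parallel d})^{\parallel d}$ exist. If $wd=dw$, then $aw$ is invertible along $d$ and $(aw)^{\parallel d}=w^{\parallel d}(aww^{\parallel d})^{\parallel d}$.
   Context: Rings are associative with identity, not necessarily commutative. An element $a\in R$ is said to be invertible along $d\in R$ (Mary invertible) if there exists $y\in R$ such that $yad=d=day$, $yR\subseteq dR$ and $Ry\subseteq Rd$. Such a $y$ is unique when it exists and is denoted $a^{\parallel d}$. *)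

(* Defs.v *)
From HB Require Import structures.
From mathcomp Require Import all_boot all_order all_algebra.
From mathcomp Require Import boolp classical_sets.

Set Implicit Arguments.
Unset Strict Implicit.
Unset Printing Implicit Defensive.

Import GRing.Theory.
Local Open Scope classical_set_scope.
Local Open Scope ring_scope.

Definition right_ideal_gen (R : pzRingType) (x : R) : set R :=
  [set x * r | r in [set: R]].

Definition left_ideal_gen (R : pzRingType) (x : R) : set R :=
  [set r * x | r in [set: R]].

Definition is_inverse_along (R : pzRingType) (a d y : R) : Prop :=
  [/\ y * a * d = d, d = d * a * y,
      right_ideal_gen y `<=` right_ideal_gen d &
      left_ideal_gen y `<=` left_ideal_gen d].

Definition invertible_along (R : pzRingType) (a d : R) : Prop :=
  exists y : R, is_inverse_along a d y.

(* The default value 0 is returned when a is not invertible along d. *)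
Definition inverse_along (R : pzRingType) (a d : R) : R :=
  xget 0 [set y | is_inverse_along a d y].

Lemma is_inverse_along_uniq (R : pzRingType) (a d y z : R) :
  is_inverse_along a d y -> is_inverse_along a d z -> y = z.
Proof.
move=> [_ day yR _] [zad _ _ Rz].
have [s _ ys] : right_ideal_gen d y by apply: yR; exists 1; rewrite // mulr1.
have [t _ zt] : left_ideal_gen d z by apply: Rz; exists 1; rewrite // mul1r.
have zay1 : z * a * y = y by rewrite -ys mulrA zad.
by rewrite -zay1 -zt -!mulrA (mulrA d) -day.
Qed.

Lemma inverse_alongP (R : pzRingType) (a d : R) :
  invertible_along a d -> is_inverse_along a d (inverse_along a d).
Proof. by move=> [y ady]; exact: xgetI ady. Qed.

Lemma inverse_along_eq (R : pzRingType) (a d y : R) :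
  is_inverse_along a d y -> inverse_along a d = y.
Proof.
move=> ady; apply/esym/(is_inverse_along_uniq ady).
by apply: inverse_alongP; exists y.
Qed.

(* Main.v *)
(* The inverse y of a along d commutes with a as soon as d does: with
   y = d s = t d, both y a and a y equal y a a y. In (i), writing z for the
   inverse of y a w along d, this gives d w = d (y a w), hence d w z = d, and
   then d (a w) (z y) = a (d w z) y = a d y = d; (ii) is the mirror image. *)

Require Import Defs.
From HB Require Import structures.
From mathcomp Require Import all_boot all_order all_algebra.

Set Implicit Arguments.
Unset Strict Implicit.
Unset Printing Implicit Defensive.

Import GRing.Theory.
Local Open Scope ring_scope.

(** A principal one-sided ideal lies in another exactly when its generator does, so each inclusion
    becomes a factorization of [y] through [d]. *)
Lemma is_inverse_alongP (R : pzRingType) (a d y : R) :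
  is_inverse_along a d y <->
  [/\ y * a * d = d, d * a * y = d, exists s, y = d * s & exists t, y = t * d].
Proof.
split=> [[yad day yR Ry]|[yad day [s ys] [t yt]]].
  split=> //.
  - have [|s _ ys] := yR y; first by exists 1; rewrite ?mulr1.
    by exists s.
  - have [|t _ yt] := Ry y; first by exists 1; rewrite ?mul1r.
    by exists t.
split=> // _ [r _ <-].
- by exists (s * r); rewrite // mulrA -ys.
- by exists (r * t); rewrite // -mulrA -yt.
Qed.

Lemma is_inverse_along_comm (R : pzRingType) (a d y : R) :
  is_inverse_along a d y -> a * d = d * a -> y * a = a * y.
Proof.
move=> /is_inverse_alongP[yad day [s ys] [t yt]] ad.
have yaay_l : y * a * a * y = a * y.
  (* The [d] in [y = d * s] moves left past [a], where [y * a] fixes it. *)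
  by rewrite {2 3}ys -(mulrA _ a) (mulrA a d) ad !mulrA yad.
have yaay_r : y * a * a * y = y * a.
  by rewrite {1 3}yt -(mulrA t d a) -ad -!mulrA (mulrA d a y) day.
by rewrite -yaay_r yaay_l.
Qed.

Lemma is_inverse_along_mull (R : pzRingType) (a w d y z : R) :
  is_inverse_along a d y -> is_inverse_along (y * a * w) d z ->
  a * d = d * a -> is_inverse_along (a * w) d (z * y).
Proof.
move=> ady bdz ad; have ya := is_inverse_along_comm ady ad.
move: ady bdz => /is_inverse_alongP[yad day _ [t yt]].
move=> /is_inverse_alongP[zbd dbz [s zs] _].
apply/is_inverse_alongP; split.
- by rewrite -[RHS]zbd !mulrA.
(* Swapping [y * a] into [a * y] exposes [d * a * y], which collapses to [d]. *)
- have dwz : d * w * z = d by rewrite -[RHS]dbz ya !mulrA day.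
  (* With [a] pulled out in front of [d], [dwz] applies; [a] then returns to its place to leave
     [d * a * y]. *)
  by rewrite !mulrA -ad -!(mulrA a) dwz mulrA ad.
- by exists (s * y); rewrite mulrA -zs.
- by exists (z * t); rewrite -mulrA -yt.
Qed.

(** This is the previous lemma read in the opposite ring, with [a] and [w] exchanged. *)
Lemma is_inverse_along_mulr (R : pzRingType) (a w d y z : R) :
  is_inverse_along w d y -> is_inverse_along (a * w * y) d z ->
  w * d = d * w -> is_inverse_along (a * w) d (y * z).
Proof.
move=> wdy cdz wd; have yw := is_inverse_along_comm wdy wd.
move: wdy cdz => /is_inverse_alongP[ywd dwy [s ys] _].
move=> /is_inverse_alongP[zcd dcz _ [t zt]].
apply/is_inverse_alongP; split.
(* The counterpart of [dwz]: [w * y] becomes [y * w], which fixes [d] from the left. *)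
- have zad : z * a * d = d by rewrite -[RHS]zcd -(mulrA a) -yw -!mulrA (mulrA y) ywd.
  by rewrite -!mulrA wd (mulrA a) (mulrA z) (mulrA z) zad -wd mulrA.
- by rewrite -[RHS]dcz !mulrA.
- by exists (s * z); rewrite mulrA -ys.
- by exists (y * t); rewrite -mulrA -zt.
Qed.

Theorem corollary2p12 (R : pzRingType) (a w d : R) :
  (invertible_along a d ->
   invertible_along (inverse_along a d * a * w) d ->
   a * d = d * a ->
   invertible_along (a * w) d /\
   inverse_along (a * w) d =
     inverse_along (inverse_along a d * a * w) d * inverse_along a d)
  /\
  (invertible_along w d ->
   invertible_along (a * w * inverse_along w d) d ->
   w * d = d * w ->
   invertible_along (a * w) d /\
   inverse_along (a * w) d =
     inverse_along w d * inverse_along (a * w * inverse_along w d) d).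
Proof.
(* Each existence hypothesis is traded for the chosen inverse, so the products built below are those
   of the stated formulas. *)
split=> /inverse_alongP inv1 /inverse_alongP inv2 comm.
- have inv := is_inverse_along_mull inv1 inv2 comm.
  by split; [eexists; exact: inv | exact: inverse_along_eq].
- have inv := is_inverse_along_mulr inv1 inv2 comm.
  by split; [eexists; exact: inv | exact: inverse_along_eq].
Qed.
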